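(* Let $d\geq 2$, let $G\leq\mathrm{Aut}(\mathcal{T}_d)$ be a contracting self-similar group, let $V_dG$ be the associated Röver–Nekrashevych group, and let $S$ be a finite set of rational points in $\mathfrak{C}_d$. Then the stabilizer of $S$ in $V_dG$, i.e. the setwise stabilizer $\{h\in V_dG\mid h(S)=S\}$, is finitely generated.
   Context: For $d\geq 2$, let $X_d=\{0,\ldots,d-1\}$, let $X_d^*$ (respectively $X_d^+$) be the set of finite words (respectively nonempty finite words) over $X_d$, and let $\mathcal{T}_d$ be the infinite rooted $d$-ary tree whose nodes are the elements of $X_d^*$. If $g\in \mathrm{Aut}(\mathcal{T}_d)$ (rooted tree automorphisms) and $\alpha\in X_d^*$, the local action of $g$ at $\alpha$ is the unique $g|_\alpha\in \mathrm{Aut}(\mathcal{T}_d)$ such that $g(\alpha\cdot\beta)=g(\alpha)\cdot g|_\alpha(\beta)$ for every $\beta\in X_d^*$, where $\cdot$ denotes concatenation. A group $G\leq\mathrm{Aut}(\mathcal{T}_d)$ is self-similar if $g|_\alpha\in G$ for all $g\in G$ and $\alpha\in X_d^*$. A self-similar group $G$ is contracting if there exists a finite set $\mathcal{N}\subseteq G$ such that for every $g\in G$ the set $\{\alpha\in X_d^*\mid g|_\alpha\notin\mathcal{N}\}$ is finite. Let $\mathfrak{C}_d=X_d^\omega$ be the Cantor space of infinite words over $X_d$ (product topology); $\mathrm{Aut}(\mathcal{T}_d)$ acts faithfully on $\mathfrak{C}_d$ by homeomorphisms, and its elements are identified with the corresponding homeomorphisms. For $\alpha\in X_d^*$, the cone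 $\alpha\mathfrak{C}_d$ is the set of all infinite words having $\alpha$ as a prefix. If $h\in\mathrm{Homeo}(\mathfrak{C}_d)$ maps a cone $\alpha\mathfrak{C}_d$ onto a cone $\beta\mathfrak{C}_d$, the local action $h|_\alpha$ is the homeomorphism of $\mathfrak{C}_d$ defined by $h(\alpha\cdot\psi)=\beta\cdot h|_\alpha(\psi)$ for all $\psi\in X_d^\omega$. For a self-similar group $G$, the Röver–Nekrashevych group $V_dG$ is the group of all $h\in\mathrm{Homeo}(\mathfrak{C}_d)$ such that for every $p\in\mathfrak{C}_d$ there exists a cone $\alpha\mathfrak{C}_d$ containing $p$ such that $h(\alpha\mathfrak{C}_d)$ is a cone and $h|_\alpha\in G$. A point $p\in\mathfrak{C}_d$ is rational if it has the form $\alpha\overline{\beta}=\alpha\beta\beta\beta\cdots$ for some $\alpha\in X_d^*$ and $\beta\in X_d^+$. *)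

(* Defs.v *)
From HB Require Import structures.
From mathcomp Require Import all_boot.
From mathcomp Require Import all_classical.
From mathcomp Require Import topology function_spaces.

Set Implicit Arguments.
Unset Strict Implicit.
Unset Printing Implicit Defensive.

Local Open Scope classical_set_scope.

Section Subgroups.
Context {gT : groupType}.
Implicit Types H A : set gT.

Definition is_subgroup H : Prop := group_closed (mem H).

Definition finitely_generated H : Prop :=
  exists2 A, finite_set A & smallest is_subgroup A = H.

Lemma is_subgroupP H :
  is_subgroup H <-> H 1%g /\ (forall x y, H x -> H y -> H (x / y)%g).
Proof.
split=> -[H1 HV]; split.
- by move: H1; rewrite inE.
- by move=> x y Hx Hy; have := HV x y; rewrite !inE; apply.
- by rewrite inE.
- by move=> x y; rewrite !inE; exact: HV.
Qed.

End Subgroups.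

Section Homeomorphisms.
Context {T : topologicalType}.

Record homeo : Type := Homeo {
  homeo_fun :> T -> T;
  homeo_inv : T -> T;
  homeoK : cancel homeo_fun homeo_inv;
  homeoVK : cancel homeo_inv homeo_fun;
  homeo_cont : continuous homeo_fun;
  homeoV_cont : continuous homeo_inv }.

Lemma homeo_ext (h k : homeo) : h =1 k -> h = k.
Proof.
case: h k => [f f' fK fVK cf cf'] [g g' gK gVK cg cg'] /= /funext fg.
have fg' : f' = g' by apply/funext => x; rewrite -{1}(gVK x) -fg fK.
by subst; congr Homeo; exact: Prop_irrelevance.
Qed.

HB.instance Definition _ := gen_eqMixin homeo.
HB.instance Definition _ := gen_choiceMixin homeo.

Definition homeo1 : homeo :=
  @Homeo id id (fun=> erefl) (fun=> erefl) (fun=> cvg_id) (fun=> cvg_id).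

Definition homeoV (h : homeo) : homeo :=
  Homeo (@homeoVK h) (@homeoK h) (@homeoV_cont h) (@homeo_cont h).

Definition homeoM (h k : homeo) : homeo :=
  @Homeo (h \o k) (homeo_inv k \o homeo_inv h)
    (can_comp (@homeoK h) (@homeoK k)) (can_comp (@homeoVK k) (@homeoVK h))
    (fun x => continuous_comp (@homeo_cont k x) (@homeo_cont h _))
    (fun x => continuous_comp (@homeoV_cont h x) (@homeoV_cont k _)).

Lemma homeoMA : associative homeoM.
Proof. by move=> h k l; exact: homeo_ext. Qed.
Lemma homeo1M : left_id homeo1 homeoM.
Proof. by move=> h; exact: homeo_ext. Qed.
Lemma homeoM1 : right_id homeo1 homeoM.
Proof. by move=> h; exact: homeo_ext. Qed.
Lemma homeoMV : left_inverse homeo1 homeoV homeoM.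
Proof. by move=> h; apply: homeo_ext => x; exact: homeoK. Qed.
Lemma homeoVM : right_inverse homeo1 homeoV homeoM.
Proof. by move=> h; apply: homeo_ext => x; exact: homeoVK. Qed.

HB.instance Definition _ :=
  isGroup.Build homeo homeoMA homeo1M homeoM1 homeoMV homeoVM.

End Homeomorphisms.
Arguments homeo : clear implicits.

Definition word (d : nat) : Type := seq 'I_d.

Section TreeAutomorphisms.
Context {d : nat}.
Implicit Types u v a b : word d.

(* The edges of the rooted tree join each word to its one-letter extensions. *)
Definition tree_adj u v : Prop :=
  exists x, v = rcons u x \/ u = rcons v x.

Record tree_aut : Type := TreeAut {
  aut_fun :> word d -> word d;
  aut_inv : word d -> word d;
  autK : cancel aut_fun aut_inv;
  autVK : cancel aut_inv aut_fun;
  aut_root : aut_fun [::] = [::];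
  aut_adj : forall u v, tree_adj (aut_fun u) (aut_fun v) <-> tree_adj u v }.

Implicit Types g k : tree_aut.

Lemma aut_ext g k : g =1 k -> g = k.
Proof.
case: g k => [f f' fK fVK f0 fA] [g g' gK gVK g0 gA] /= /funext fg.
have fg' : f' = g' by apply/funext => x; rewrite -{1}(gVK x) -fg fK.
by subst; congr TreeAut; exact: Prop_irrelevance.
Qed.

HB.instance Definition _ := gen_eqMixin tree_aut.
HB.instance Definition _ := gen_choiceMixin tree_aut.

Definition aut1 : tree_aut :=
  @TreeAut id id (fun=> erefl) (fun=> erefl) erefl (fun _ _ => iff_refl _).

Lemma autV_root g : aut_inv g [::] = [::].
Proof. by rewrite -{1}(aut_root g) autK. Qed.

Lemma autV_adj g u v : tree_adj (aut_inv g u) (aut_inv g v) <-> tree_adj u v.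
Proof. by rewrite -(aut_adj g) !autVK. Qed.

Definition autV g : tree_aut :=
  TreeAut (@autVK g) (@autK g) (autV_root g) (autV_adj g).

Lemma autM_root g k : (g \o k) [::] = [::].
Proof. by rewrite /= !aut_root. Qed.

Lemma autM_adj g k u v :
  tree_adj ((g \o k) u) ((g \o k) v) <-> tree_adj u v.
Proof. by rewrite /= !aut_adj. Qed.

Definition autM g k : tree_aut :=
  @TreeAut (g \o k) (aut_inv k \o aut_inv g)
    (can_comp (@autK g) (@autK k)) (can_comp (@autVK k) (@autVK g))
    (autM_root g k) (autM_adj g k).

Lemma autMA : associative autM.
Proof. by move=> h k l; exact: aut_ext. Qed.
Lemma aut1M : left_id aut1 autM.
Proof. by move=> h; exact: aut_ext. Qed.
Lemma autM1 : right_id aut1 autM.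
Proof. by move=> h; exact: aut_ext. Qed.
Lemma autMV : left_inverse aut1 autV autM.
Proof. by move=> h; apply: aut_ext => x; exact: autK. Qed.
Lemma autVM : right_inverse aut1 autV autM.
Proof. by move=> h; apply: aut_ext => x; exact: autVK. Qed.

HB.instance Definition _ :=
  isGroup.Build tree_aut autMA aut1M autM1 autMV autVM.

Lemma aut_child_size g n u : size u = n ->
  size (g u) = n /\ forall x, exists y, g (rcons u x) = rcons (g u) y.
Proof.
elim: n u => [|n IH] u su.
  move/size0nil: su => ->; rewrite aut_root; split=> // x.
  have [|y [e|/(congr1 size)]] := (aut_adj g [::] [:: x]).2.
  - by exists x; left.
  - by exists y; rewrite e aut_root.
  - by rewrite aut_root size_rcons.
case/lastP: u su => // u z; rewrite size_rcons => -[su].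
have [su' /(_ z)[t gt]] := IH u su.
split; first by rewrite gt size_rcons su'.
move=> x.
have [|y [->|e]] := (aut_adj g (rcons u z) (rcons (rcons u z) x)).2.
- by exists x; left.
- by exists y.
- move: e; rewrite gt => /rcons_inj[/(can_inj (@autK g))/(congr1 size)].
  by rewrite !size_rcons => /eqP; rewrite -[X in X == _]addn0 -addn2 eqn_add2l.
Qed.

Lemma size_aut g u : size (g u) = size u.
Proof. by have [] := aut_child_size g (erefl (size u)). Qed.

Lemma aut_cat g a b : g (a ++ b) = g a ++ drop (size a) (g (a ++ b)).
Proof.
elim/last_ind: b => [|b x IH].
  by rewrite cats0 drop_oversize ?cats0 // size_aut.
have [_ /(_ x)[y e]] := aut_child_size g (erefl (size (a ++ b))).
rewrite -rcons_cat e [in LHS]IH drop_rcons ?rcons_cat //.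
by rewrite size_aut size_cat leq_addr.
Qed.

Lemma take_aut g a b : take (size a) (g (a ++ b)) = g a.
Proof. by rewrite aut_cat take_size_cat // size_aut. Qed.

Section LocalAction.
Variables (g : tree_aut) (a : word d).

Let f b := drop (size a) (g (a ++ b)).
Let f' b := drop (size a) (aut_inv g (g a ++ b)).

Let cat_f b : g (a ++ b) = g a ++ f b.
Proof. exact: aut_cat. Qed.

Let fK : cancel f f'.
Proof. by move=> b; rewrite /f' -cat_f autK drop_size_cat. Qed.

Let fVK : cancel f' f.
Proof.
move=> b; rewrite /f /f'.
have e : a ++ drop (size a) (aut_inv g (g a ++ b)) = aut_inv g (g a ++ b).
  have := aut_cat (autV g) (g a) b; rewrite /= autK size_aut.
  by move=> {2}->.
by rewrite e autVK drop_size_cat // size_aut.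
Qed.

Let f_root : f [::] = [::].
Proof. by rewrite /f cats0 drop_oversize // size_aut. Qed.

Let adj_cat (c u v : word d) : tree_adj (c ++ u) (c ++ v) <-> tree_adj u v.
Proof.
split=> -[x]; last by case=> ->; exists x; rewrite -rcons_cat; [left|right].
by case=> e; exists x; [left|right]; apply/eqP; move/eqP: e;
  rewrite rcons_cat eqseq_cat // eqxx.
Qed.

Let f_adj u v : tree_adj (f u) (f v) <-> tree_adj u v.
Proof. by rewrite -(adj_cat (g a)) -!cat_f aut_adj adj_cat. Qed.

Definition local_action : tree_aut := TreeAut fK fVK f_root f_adj.

Lemma local_actionP b : g (a ++ b) = g a ++ local_action b.
Proof. exact: cat_f. Qed.

Lemma local_action_unique k :
  (forall b, g (a ++ b) = g a ++ k b) -> k = local_action.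
Proof.
move=> gk; apply: aut_ext => b.
by have /eqP := gk b; rewrite local_actionP eqseq_cat // eqxx => /eqP.
Qed.

End LocalAction.

Definition self_similar (G : set tree_aut) : Prop :=
  forall g a, G g -> G (local_action g a).

Definition contracting (G : set tree_aut) : Prop :=
  exists N : set tree_aut, [/\ finite_set N, N `<=` G &
    forall g, G g -> finite_set [set a | ~ N (local_action g a)]].

End TreeAutomorphisms.
Arguments tree_aut : clear implicits.

Definition cantor (d : nat) : topologicalType :=
  {ptws nat -> discrete_topology 'I_d}.

Section Cantor.
Context {d : nat}.
Implicit Types (a b : word d) (p q : cantor d).

(* The default value of [nth] is never used, here and in [boundary_fun]; drawing
   it from [p] avoids assuming that ['I_d] is inhabited. *)
Definition wcat a p : cantor d :=
  fun n => if n < size a then nth (p 0) a n else p (n - size a).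

Definition wprefix p n : word d := mkseq p n.

Definition cone a : set (cantor d) := range (wcat a).

(* [periodic x b] is the infinite repetition of the nonempty word [x :: b]. *)
Definition periodic (x : 'I_d) b : cantor d :=
  fun n => nth x (x :: b) (n %% (size b).+1).

Definition rational p : Prop := exists a x b, p = wcat a (periodic x b).

Lemma size_wprefix p n : size (wprefix p n) = n.
Proof. exact: size_mkseq. Qed.

Lemma wprefixS p n : wprefix p n.+1 = rcons (wprefix p n) (p n).
Proof. by rewrite /wprefix /mkseq -addn1 iotaD map_cat /= cats1. Qed.

Lemma nbhs_wprefix p n : nbhs p [set q | wprefix q n = wprefix p n].
Proof.
elim: n => [|n IH]; first exact: filterS filterT.
have pn : nbhs p [set q : cantor d | q n = p n].
  exact: (@proj_continuous _ (fun=> discrete_topology 'I_d) n p [set p n]).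
apply: filterS (filterI IH pn) => q [/= e en].
by rewrite !wprefixS e en.
Qed.

Lemma cantor_continuous (f : cantor d -> cantor d) :
  (forall p n, exists m, forall q, wprefix q m = wprefix p m -> f q n = f p n) ->
  continuous f.
Proof.
move=> fP p; have F : Filter (f x @[x --> p]) .
  exact: (@fmap_filter _ _ f (nbhs p) (nbhs_filter p)).
apply/cvg_sup => n U [V [[W oW <-] /= Wfp WU]].
have [m fm] := fP p n; apply: filterS (nbhs_wprefix p m) => q /fm e.
by apply: WU; rewrite /= e.
Qed.

Lemma wprefix_inj p q : (forall n, wprefix p n = wprefix q n) -> p = q.
Proof.
move=> pq; apply/funext => n; have := pq n.+1.
by rewrite !wprefixS => /rcons_inj[].
Qed.

Section Boundary.
Variable g : tree_aut d.

Definition boundary_fun p : cantor d :=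
  fun n => nth (p n) (g (wprefix p n.+1)) n.

Lemma wprefix_boundary_fun p n :
  wprefix (boundary_fun p) n = g (wprefix p n).
Proof.
elim: n => [|n IH]; first by rewrite aut_root.
rewrite wprefixS IH wprefixS.
have [_ /(_ (p n))[y e]] := aut_child_size g (size_wprefix p n).
by rewrite /boundary_fun wprefixS e nth_rcons size_aut size_wprefix ltnn eqxx.
Qed.

Lemma boundary_fun_continuous : continuous boundary_fun.
Proof.
apply: cantor_continuous => p n; exists n.+1 => q.
move=> /(congr1 g); rewrite -!wprefix_boundary_fun !wprefixS.
by move=> /rcons_inj[].
Qed.

End Boundary.

Lemma boundary_funK (g : tree_aut d) :
  cancel (boundary_fun g) (boundary_fun (autV g)).
Proof.
by move=> p; apply: wprefix_inj => n; rewrite !wprefix_boundary_fun /= autK.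
Qed.

Lemma boundary_funVK (g : tree_aut d) :
  cancel (boundary_fun (autV g)) (boundary_fun g).
Proof.
by move=> p; apply: wprefix_inj => n; rewrite !wprefix_boundary_fun /= autVK.
Qed.

(* The homeomorphism identified with [g]; [boundaryP] characterizes it. *)
Definition boundary (g : tree_aut d) : homeo (cantor d) :=
  Homeo (boundary_funK g) (boundary_funVK g)
    (@boundary_fun_continuous g) (@boundary_fun_continuous (autV g)).

Lemma boundaryP (g : tree_aut d) p n :
  wprefix (boundary g p) n = g (wprefix p n).
Proof. exact: wprefix_boundary_fun. Qed.

(* [k] is the local action of [h] at [a], when [h] maps the cone of [a] onto
   the cone of [b]. *)
Definition is_local_action (h : homeo (cantor d)) a b (k : homeo (cantor d)) :=
  forall p, h (wcat a p) = wcat b (k p).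

Definition rover_nekrashevych (G : set (tree_aut d)) : set (homeo (cantor d)) :=
  [set h : homeo (cantor d) | forall p, exists2 a, cone a p &
    exists2 b, h @` cone a = cone b &
    exists2 g, G g & is_local_action h a b (boundary g)].

Definition setwise_stabilizer (H : set (homeo (cantor d))) (S : set (cantor d)) :
  set (homeo (cantor d)) := [set h : homeo (cantor d) | H h /\ h @` S = S].

End Cantor.

(* Main.v *)
Require Import Defs.
From mathcomp Require Import all_boot.
From mathcomp Require Import all_classical.
From mathcomp Require Import topology function_spaces.

(* Fix a finite M containing 1 and a nucleus of G, and a level n beyond which
   the points of S are separated and periodic with period m, and at which some
   word a0 is not a prefix of a point of S.

   Elements supported off the cones of the length-n prefixes of S: by
   compactness such an h carries a code A (a partition into cones) to a code B
   of the same size, acting on each cone by an element of M. If A and B share a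
   word, a flip of two cones makes h map this word to itself and it can be
   discarded. Otherwise some word of A is a proper prefix of one of B and some
   word of B is a proper prefix of one of A, and flipping these two words makes
   A and B share a word. So these elements are generated by flips, and by
   conjugation flips of cones of two successive depths suffice.

   The stabilizer: each p in S is fixed by a product of two flips that shifts
   the cone at p one period deeper. Composing h on both sides with powers of
   these, the image of the cone of the length-n prefix of p becomes a cone of
   depth between n and n + m, with local action in M. This leaves finitely many
   possible germs at S, and two elements of the stabilizer with the same germs
   differ by an element supported off the cones at S. *)

Set Implicit Arguments.
Unset Strict Implicit.
Unset Printing Implicit Defensive.

Local Open Scope classical_set_scope.

(** * Words, points and cones *)

Section Words.
Context {d : nat}.
Implicit Types (a b c : word d) (p q : cantor d) (n : nat).

Definition wdrop n p : cantor d := fun k => p (n + k).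

(** Comparability in the prefix order; by [in_cone_nested], two words whose cones meet are
    nested. *)
Definition nested a b := prefix a b || prefix b a.

Lemma nested_sym a b : nested a b = nested b a.
Proof. exact: orbC. Qed.

Lemma nested_prefix a b c : prefix a c -> prefix b c -> nested a b.
Proof.
rewrite /nested; elim: c a b => [|z c IH] [|x a] [|y b] //=.
by case: eqP => // -> ac; case: eqP => // -> bc; rewrite /= !eqxx /=; exact: IH.
Qed.

Lemma prefix_nested b c :
  nested b c -> size b <= size c -> prefix b c.
Proof.
case/orP=> // /prefixP[e ->]; rewrite size_cat -{2}[size c]addn0 leq_add2l.
by rewrite leqn0 size_eq0 => /eqP->; rewrite cats0 prefix_refl.
Qed.

Lemma wprefixD p m n :
  wprefix p (m + n) = wprefix p m ++ wprefix (wdrop m p) n.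
Proof.
elim: n => [|n IH]; first by rewrite addn0 cats0.
by rewrite addnS !wprefixS IH rcons_cat.
Qed.

Lemma wprefix_wcat a p n : wprefix (wcat a p) (size a + n) = a ++ wprefix p n.
Proof.
apply: (@eq_from_nth _ (p 0)); first by rewrite size_cat !size_wprefix.
move=> i; rewrite size_wprefix => lti; rewrite nth_mkseq // nth_cat /wcat.
by case: ltnP => // ai; rewrite nth_mkseq // ltn_subLR.
Qed.

Lemma wprefix_wcat_size a p : wprefix (wcat a p) (size a) = a.
Proof. by rewrite -[X in wprefix _ X]addn0 wprefix_wcat cats0. Qed.

Lemma wdrop_wcat a p : wdrop (size a) (wcat a p) = p.
Proof.
by apply/funext => n; rewrite /wdrop /wcat ltnNge leq_addr addKn.
Qed.

Lemma wcat_wdrop p n : wcat (wprefix p n) (wdrop n p) = p.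
Proof.
apply/funext => i; rewrite /wcat size_wprefix /wdrop.
by case: ltnP => ni; [rewrite nth_mkseq|rewrite subnKC].
Qed.

Lemma wcat_cat a b p : wcat (a ++ b) p = wcat a (wcat b p).
Proof.
apply/funext => i; rewrite /wcat size_cat nth_cat.
case: (ltnP i (size a)) => ai.
  by rewrite ltn_addr //; exact: set_nth_default.
by rewrite ltn_subLR // subnDA.
Qed.

Lemma wdropD m n p : wdrop n (wdrop m p) = wdrop (m + n) p.
Proof. by apply/funext => k; rewrite /wdrop addnA. Qed.

(** Boolean counterpart of [cone], on which [flip_fun] can branch. *)
Definition in_cone a p := wprefix p (size a) == a.

Lemma in_coneP a p : reflect (exists q, p = wcat a q) (in_cone a p).
Proof.
apply: (iffP eqP) => [e|[q ->]]; last exact: wprefix_wcat_size.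
by exists (wdrop (size a) p); rewrite -{1}e wcat_wdrop.
Qed.

Lemma in_cone_wcat a p : in_cone a (wcat a p).
Proof. by apply/in_coneP; exists p. Qed.

Lemma in_cone_wprefix p n : in_cone (wprefix p n) p.
Proof. by rewrite /in_cone size_wprefix. Qed.

Lemma in_coneE a p n : size a <= n -> in_cone a p = prefix a (wprefix p n).
Proof.
move=> /subnKC <-; rewrite wprefixD prefixE take_cat size_wprefix ltnn subnn.
by rewrite take0 cats0.
Qed.

Lemma in_cone_prefix a b p : prefix a b -> in_cone b p -> in_cone a p.
Proof.
by case/prefixP=> c -> /in_coneP[q ->]; rewrite wcat_cat in_cone_wcat.
Qed.

Lemma in_cone_nested a b p : in_cone a p -> in_cone b p -> nested a b.
Proof.
rewrite (@in_coneE a p (size a + size b)) ?leq_addr //.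
rewrite (@in_coneE b p (size a + size b)) ?leq_addl //.
exact: nested_prefix.
Qed.

Lemma in_cone_size a b p :
  in_cone a p -> in_cone b p -> size a = size b -> a = b.
Proof. by move=> /eqP {2}<- /eqP {2}<- ->. Qed.

Lemma boundary1 p : boundary 1%g p = p.
Proof. by apply: wprefix_inj => n; rewrite boundaryP. Qed.

Lemma boundaryM g k p : boundary (g * k)%g p = boundary g (boundary k p).
Proof. by apply: wprefix_inj => n; rewrite !boundaryP. Qed.

Lemma boundary_invgK g p : boundary g^-1%g (boundary g p) = p.
Proof. by rewrite -boundaryM mulVg boundary1. Qed.

Lemma boundary_invgVK g p : boundary g (boundary g^-1%g p) = p.
Proof. by rewrite -boundaryM mulgV boundary1. Qed.

Lemma boundary_wcat g a p :
  boundary g (wcat a p) = wcat (g a) (boundary (local_action g a) p).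
Proof.
apply: wprefix_inj => n; have := boundaryP g (wcat a p) (size a + n).
rewrite wprefix_wcat local_actionP -{1}(size_aut g a).
have := wprefix_wcat (g a) (boundary (local_action g a) p) n.
rewrite boundaryP => <-; rewrite addnC => /(congr1 (take n)).
by rewrite !wprefixD !take_cat !size_wprefix !ltnn subnn !take0 !cats0.
Qed.

End Words.

(** * Inclusions between cones *)

Section Acts.
Context {d : nat} (d_gt1 : 1 < d).
Implicit Types (a b c : word d) (p q : cantor d) (g : tree_aut d).
Implicit Types (h k : homeo (cantor d)).

Let letter0 : 'I_d := Ordinal (ltnW d_gt1).
Let letter1 : 'I_d := Ordinal d_gt1.

Lemma other_letter (x : 'I_d) : exists y, y != x.
Proof.
have [e|] := eqVneq letter1 x; last by exists letter1.
by exists letter0; rewrite -e.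
Qed.

(** If [b] extended [a] properly, with next letter [x], a point of the cone of [a] continuing with a
    letter other than [x] would miss the cone of [b]. *)
Lemma in_cone_inj a b : (forall p, in_cone a p -> in_cone b p) -> prefix b a.
Proof.
move=> ab; pose p := wcat a (fun=> letter0).
have /orP[/prefixP[c e]|//] := in_cone_nested (in_cone_wcat a _)
  (ab p (in_cone_wcat a _)).
case: c e => [|x c] e; first by rewrite e cats0 prefix_refl.
have [y yx] := other_letter x.
have /in_coneP[q] := ab _ (in_cone_wcat a (fun=> y)).
rewrite e wcat_cat => /(congr1 (wdrop (size a))); rewrite !wdrop_wcat.
by move=> /(congr1 (@^~ 0)) /= yE; rewrite yE eqxx in yx.
Qed.

End Acts.

(** * Homeomorphisms acting between cones, and flips *)

Section Moves.
Context {d : nat}.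
Implicit Types (a b c e : word d) (p q : cantor d) (g : tree_aut d).
Implicit Types (h k : homeo (cantor d)).

Definition acts h a b g := is_local_action h a b (boundary g).

Definition moves h a b := forall p, h (wcat a p) = wcat b p.

Lemma homeoME h k p : (h * k)%g p = h (k p). Proof. by []. Qed.

Lemma homeo_invgK h p : h^-1%g (h p) = p. Proof. exact: homeoK. Qed.

Lemma homeo_invgVK h p : h (h^-1%g p) = p. Proof. exact: homeoVK. Qed.

Lemma homeo_inj h : injective h.
Proof. exact: can_inj (homeo_invgK h). Qed.

Lemma moves_acts h a b : moves h a b <-> acts h a b 1%g.
Proof. by split=> H p; have := H p; rewrite boundary1. Qed.

Lemma moves_cat h a b c : moves h a b -> moves h (a ++ c) (b ++ c).
Proof. by move=> hab p; rewrite !wcat_cat hab. Qed.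

Lemma movesV h a b : moves h a b -> moves h^-1%g b a.
Proof. by move=> hab p; rewrite -hab homeo_invgK. Qed.

Lemma movesM h k a b c : moves h a b -> moves k b c -> moves (k * h)%g a c.
Proof. by move=> hab kbc p; rewrite homeoME hab kbc. Qed.

Lemma acts_moves h k a b c g :
  acts h a b g -> moves k b c -> acts (k * h)%g a c g.
Proof. by move=> hab kbc p; rewrite homeoME hab kbc. Qed.

Lemma moves_actsM h k a b c g :
  moves h a b -> acts k b c g -> acts (k * h)%g a c g.
Proof. by move=> hab kbc p; rewrite homeoME hab kbc. Qed.

Lemma actsM h k a b c g g' :
  acts h a b g -> acts k b c g' -> acts (k * h)%g a c (g' * g)%g.
Proof. by move=> hab kbc p; rewrite homeoME hab kbc boundaryM. Qed.

Lemma actsV h a b g : acts h a b g -> acts h^-1%g b a g^-1%g.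
Proof. by move=> hab p; rewrite -{1}[p](boundary_invgVK g) -hab homeo_invgK. Qed.

Lemma acts_cat h a b c g :
  acts h a b g -> acts h (a ++ c) (b ++ g c) (local_action g c).
Proof. by move=> hab p; rewrite !wcat_cat hab boundary_wcat. Qed.

Lemma acts_in_cone h a b g p : acts h a b g -> in_cone b (h p) = in_cone a p.
Proof.
move=> hab; apply/in_coneP/in_coneP => -[q e].
  by exists (boundary g^-1%g q); apply: (@homeo_inj h); rewrite hab boundary_invgVK.
by exists (boundary g q); rewrite e hab.
Qed.

Lemma acts_image h a b g : acts h a b g -> h @` cone a = cone b.
Proof.
move=> hab; apply/seteqP; split=> x.
  by move=> [_ [q _ <-] <-]; rewrite hab; exists (boundary g q).
move=> [q _ <-]; exists (wcat a (boundary g^-1%g q)).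
  by exists (boundary g^-1%g q).
by rewrite hab boundary_invgVK.
Qed.

(** Exchanges two cones, by [g] one way and [g^-1] back. If [a = b] the first branch prevails, and
    [g] acts on the single cone. *)
Definition flip_fun a b g p : cantor d :=
  if in_cone a p then wcat b (boundary g (wdrop (size a) p))
  else if in_cone b p then wcat a (boundary g^-1%g (wdrop (size b) p)) else p.

(** The guard [a <> b] is there because for [a = b] the second clause would force [g] and its
    inverse to act alike. *)
Definition is_flip a b g h :=
  [/\ acts h a b g, a <> b -> acts h b a g^-1%g &
    forall p, ~~ in_cone a p -> ~~ in_cone b p -> h p = p].

(** Either one cone acted on in place, or two disjoint cones to exchange. *)
Definition flippable a b := (a == b) || ~~ nested a b.

Lemma flippable_sym a b : flippable a b = flippable b a.
Proof. by rewrite /flippable eq_sym nested_sym. Qed.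

Lemma flip_funl a b g p :
  flip_fun a b g (wcat a p) = wcat b (boundary g p).
Proof. by rewrite /flip_fun in_cone_wcat wdrop_wcat. Qed.

Lemma flip_funr a b g p : flippable a b -> a <> b ->
  flip_fun a b g (wcat b p) = wcat a (boundary g^-1%g p).
Proof.
rewrite /flip_fun => /orP[/eqP//|ab _]; case: ifP => [ap|_].
  by have := in_cone_nested ap (in_cone_wcat b p); rewrite (negPf ab).
by rewrite in_cone_wcat wdrop_wcat.
Qed.

Lemma flip_funK a b g : flippable a b ->
  cancel (flip_fun a b g) (flip_fun b a g^-1%g).
Proof.
move=> ab p; have [/in_coneP[q ->]|pa] := boolP (in_cone a p).
  by rewrite !flip_funl boundary_invgK.
have [/in_coneP[q e]|pb] := boolP (in_cone b p).
  have nab : a <> b by move=> ab'; move: pa; rewrite e ab' in_cone_wcat.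
  rewrite e flip_funr // flip_funr ?invgK ?boundary_invgVK //.
    by rewrite flippable_sym.
  exact: nesym.
by rewrite /flip_fun (negPf pa) (negPf pb) (negPf pa) (negPf pb).
Qed.

Lemma eq_wprefix p q m n :
  wprefix p m = wprefix q m -> n <= m -> wprefix p n = wprefix q n.
Proof.
move=> e /subnKC nm; move: e; rewrite -nm !wprefixD => /eqP.
by rewrite eqseq_cat ?size_wprefix // => /andP[/eqP].
Qed.

Lemma wprefix_at p q n : wprefix p n.+1 = wprefix q n.+1 -> p n = q n.
Proof. by rewrite !wprefixS => /rcons_inj[]. Qed.

Lemma wprefix_wdrop p q m n :
  wprefix p (m + n) = wprefix q (m + n) ->
  wprefix (wdrop m p) n = wprefix (wdrop m q) n.
Proof.
by rewrite !wprefixD => /eqP; rewrite eqseq_cat ?size_wprefix // => /andP[_ /eqP].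
Qed.

Lemma flip_fun_continuous a b g : continuous (flip_fun a b g).
Proof.
have branch (c e : word d) (k : tree_aut d) (p q : cantor d) n :
    wprefix q (size c + n.+1) = wprefix p (size c + n.+1) ->
    wcat e (boundary k (wdrop (size c) q)) n =
    wcat e (boundary k (wdrop (size c) p)) n.
  move=> /wprefix_wdrop e1; apply: wprefix_at.
  apply: (@eq_wprefix _ _ (size e + n.+1)); last exact: leq_addl.
  by rewrite !wprefix_wcat !boundaryP e1.
apply: cantor_continuous => p n; exists (size a + size b + n.+1) => q e.
(* The chosen depth decides membership in both cones and still leaves [n.+1] letters after either
   prefix. *)
have eqc (c : word d) : size c <= size a + size b + n.+1 ->
    in_cone c q = in_cone c p by move=> cs; rewrite !(in_coneE _ cs) e.
rewrite /flip_fun !eqc ?leq_addr -?addnA ?leq_addr //; last first.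
  by rewrite addnCA leq_addr.
case: ifP => _; last case: ifP => _.
- by apply: branch; apply: eq_wprefix e _; rewrite leq_add2r leq_addr.
- by apply: branch; apply: eq_wprefix e _; rewrite leq_add2r leq_addl.
- by apply: wprefix_at; apply: eq_wprefix e _; rewrite leq_addl.
Qed.

Lemma is_flip_ex a b g : flippable a b -> exists h, is_flip a b g h.
Proof.
move=> ab; have ba : flippable b a by rewrite flippable_sym.
have fVK : cancel (flip_fun b a g^-1%g) (flip_fun a b g).
  by rewrite -{2}(invgK g); exact: flip_funK.
exists (Homeo (flip_funK g ab) fVK (@flip_fun_continuous a b g)
  (@flip_fun_continuous b a g^-1%g)); split=> [p|nab p|p pa pb] /=.
- exact: flip_funl.
- exact: flip_funr.
- by rewrite /flip_fun (negPf pa) (negPf pb).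
Qed.

(** A choice makes [flip] total in its words; the value is meaningful when [flippable a b], and is
    then unique by [is_flip_uniq]. *)
Definition flip a b g : homeo (cantor d) := xget 1%g [set h | is_flip a b g h].

Lemma flipP a b g : flippable a b -> is_flip a b g (flip a b g).
Proof. by move=> /(is_flip_ex g)/(xgetPex 1%g). Qed.

Lemma is_flip_uniq a b g h k : is_flip a b g h -> is_flip a b g k -> h = k.
Proof.
move=> [h1 h2 h3] [k1 k2 k3]; apply: homeo_ext => p.
have [/in_coneP[q ->]|pa] := boolP (in_cone a p); first by rewrite h1 k1.
have [/in_coneP[q e]|pb] := boolP (in_cone b p); last by rewrite h3 // k3.
have nab : a <> b by move=> ab; move: pa; rewrite e ab in_cone_wcat.
by rewrite e h2 // k2.
Qed.

Lemma flip_movesl a b : flippable a b -> moves (flip a b 1%g) a b.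
Proof. by move=> /(flipP 1%g)[/moves_acts]. Qed.

Lemma flip_movesr a b : flippable a b -> moves (flip a b 1%g) b a.
Proof.
move=> ab; have [/moves_acts h1 h2 _] := flipP 1%g ab.
have [e|/eqP nab] := eqVneq a b; first by move: h1; rewrite {}e.
by apply/moves_acts; have := h2 nab; rewrite invg1.
Qed.

Lemma flip_id a b g p : flippable a b ->
  ~~ in_cone a p -> ~~ in_cone b p -> flip a b g p = p.
Proof. by move=> /(flipP g)[_ _]; exact. Qed.

Lemma flippable_refl a : flippable a a.
Proof. by rewrite /flippable eqxx. Qed.

(* The word to which the flip of [c] and [e] sends [b], when [b] is not a proper
   prefix of [c] or [e]. *)
Definition flip_word c e b :=
  if prefix c b then e ++ drop (size c) b
  else if prefix e b then c ++ drop (size e) b else b.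

Lemma prefix_drop a b : prefix a b -> b = a ++ drop (size a) b.
Proof. by rewrite prefixE => /eqP e; rewrite -{1}e cat_take_drop. Qed.

Lemma flip_word_moves c e b : flippable c e ->
  (prefix b c -> b = c) -> (prefix b e -> b = e) ->
  moves (flip c e 1%g) b (flip_word c e b).
Proof.
move=> ce bc be; rewrite /flip_word.
case: ifPn => [/prefix_drop {1}->|cb].
  by apply: moves_cat; exact: flip_movesl.
case: ifPn => [/prefix_drop {1}->|eb].
  by apply: moves_cat; exact: flip_movesr.
have no c' : ~~ prefix c' b -> (prefix b c' -> b = c') -> forall p,
    ~~ in_cone c' (wcat b p).
  move=> c'b bc' p; apply/negP => /in_cone_nested /(_ (in_cone_wcat b p)).
  rewrite /nested (negPf c'b) /= => /bc' e'.
  by rewrite e' prefix_refl in c'b.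
by move=> p; rewrite flip_id ?no.
Qed.

End Moves.

(** * Conjugation of flips *)

Section Letters.
Context {d : nat} (d_gt1 : 1 < d).
Implicit Types (a b c e : word d) (p q : cantor d) (g : tree_aut d).
Implicit Types (h k : homeo (cantor d)).

Lemma moves_inj h a b c : moves h a b -> moves h a c -> b = c.
Proof.
move=> hb hc; have H b' c' : moves h a b' -> moves h a c' -> prefix c' b'.
  move=> hb' hc'; apply: (in_cone_inj d_gt1) => _ /in_coneP[p ->].
  by rewrite -hb' hc' in_cone_wcat.
by apply/eqP; move: (H _ _ hb hc) (H _ _ hc hb) => /prefixP[u ->] /prefixP[v];
  rewrite -catA -{1}[c]cats0 => /eqP; rewrite eqseq_cat // eqxx;
  case: u => //; rewrite cats0.
Qed.

(** The conjugate satisfies the three clauses of [is_flip a b g], which determine a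
    homeomorphism. *)
Lemma flip_conj a b a' b' g k : flippable a b -> flippable a' b' ->
  moves k a' a -> moves k b' b ->
  flip a b g = (k * flip a' b' g * k^-1)%g.
Proof.
move=> ab ab' ka kb; have [h1 h2 h3] := flipP g ab'.
apply: is_flip_uniq (flipP g ab) _; split.
- exact: moves_actsM (movesV ka) (acts_moves h1 kb).
- move=> nab; apply: (moves_actsM (movesV kb) (acts_moves (h2 _) ka)) => e.
  by apply: nab; apply: (moves_inj ka); rewrite e.
- move=> p pa pb; rewrite !homeoME h3 ?homeo_invgVK //.
  + apply: contra pa => /in_coneP[q e].
    by rewrite -(homeo_invgVK k p) e ka in_cone_wcat.
  + apply: contra pb => /in_coneP[q e].
    by rewrite -(homeo_invgVK k p) e kb in_cone_wcat.
Qed.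

End Letters.

(** * Closure properties of subgroups *)

Section SubgroupTheory.
Context {gT : groupType} (H : set gT) (H_subgroup : is_subgroup H).

Lemma subgroup1 : H 1%g.
Proof. by have /is_subgroupP[] := H_subgroup. Qed.

Lemma subgroupV x : H x -> H x^-1%g.
Proof.
have /is_subgroupP[H1 HD] := H_subgroup.
by move=> /(HD _ _ H1); rewrite div1g.
Qed.

Lemma subgroupM x y : H x -> H y -> H (x * y)%g.
Proof.
have /is_subgroupP[H1 HD] := H_subgroup.
by move=> Hx /subgroupV /(HD _ _ Hx); rewrite invgK.
Qed.

Lemma subgroupX x n : H x -> H (x ^+ n)%g.
Proof.
move=> Hx; elim: n => [|n IH]; first by rewrite expg0; exact: subgroup1.
by rewrite expgS; exact: subgroupM.
Qed.

End SubgroupTheory.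

Lemma smallest_subgroup (gT : groupType) (A : set gT) :
  is_subgroup (smallest is_subgroup A).
Proof.
apply/is_subgroupP; split=> [H [/subgroup1//]|x y Ax Ay H [Hs AH]].
by apply: subgroupM => //; first exact: Ax; apply: subgroupV => //; exact: Ay.
Qed.

(** * Prefix codes covering the same points *)

Section Codes.
Context {d : nat} (d_gt1 : 1 < d).
Implicit Types (a b c : word d) (A B : seq (word d)) (p : cantor d).

Let letter0 : 'I_d := Ordinal (ltnW d_gt1).

Definition antichain A := {in A &, forall a a', prefix a a' -> a = a'}.

Definition covers A p := exists2 a, a \in A & in_cone a p.

Lemma uniq_map_inj (T1 T2 : eqType) (f : T1 -> T2) (s : seq T1) :
  uniq (map f s) -> {in s &, injective f}.
Proof.
elim: s => [//|x s IH] /= /andP[xs us] y z; rewrite !inE.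
move=> /predU1P[->|ys] /predU1P[->|zs] //.
- by move=> e; move: xs; rewrite e map_f.
- by move=> e; move: xs; rewrite -e map_f.
- exact: IH.
Qed.

Lemma antichain_nested A a a' : antichain A -> a \in A -> a' \in A ->
  nested a a' -> a = a'.
Proof. by move=> Aa aA a'A /orP[|/Aa->//]; exact: Aa. Qed.

(* If no word of [A] were a prefix of a word of [B], each would extend a word of
   [B] properly; sending it there would be onto, hence injective, so a word of
   [B] would be refined by just one word of [A] and [A] would not cover. *)
Lemma codes_refine A B : uniq A -> uniq B -> antichain A -> antichain B ->
  size A = size B -> (forall p, covers A p <-> covers B p) -> A != [::] ->
  exists2 a, a \in A & exists2 b, b \in B & prefix a b.
Proof.
move=> uA uB Aa Ba sAB cAB A0; apply: contrapT => no.
have {}no a b : a \in A -> b \in B -> ~~ prefix a b.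
  by move=> aA bB; apply/negP => ab; apply: no; exists a => //; exists b.
have above a : a \in A -> has (fun b => prefix b a) B.
  move=> aA; have [|b bB bp] := (cAB (wcat a (fun=> letter0))).1.
    by exists a => //; exact: in_cone_wcat.
  have /orP[ab|ba] := in_cone_nested (in_cone_wcat a _) bp.
    by have := no _ _ aA bB; rewrite ab.
  by apply/hasP; exists b.
pose f a := nth [::] B (find (fun b => prefix b a) B).
have fB a : a \in A -> f a \in B by move=> /above; rewrite has_find; exact: mem_nth.
have fpre a : a \in A -> prefix (f a) a by move=> /above/(nth_find [::]).
have fE a b : a \in A -> b \in B -> prefix b a -> f a = b.
  move=> aA bB ba; apply: (antichain_nested Ba) => //; first exact: fB.
  exact: nested_prefix (fpre a aA) ba.
have f_onto : {subset B <= map f A}.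
  move=> b bB; have [|a aA ap] := (cAB (wcat b (fun=> letter0))).2.
    by exists b => //; exact: in_cone_wcat.
  have /orP[ab|ba] := in_cone_nested ap (in_cone_wcat b _).
    by have := no _ _ aA bB; rewrite ab.
  by apply/mapP; exists a => //; rewrite (fE a b).
have f_inj : {in A &, injective f}.
  apply/uniq_map_inj/(leq_size_uniq uB f_onto).
  by rewrite size_map sAB.
have {A0}[a aA] : exists a, a \in A.
  by case: (A) A0 => // a s _; exists a; rewrite inE eqxx.
have /prefixP[[|x c] e] := fpre a aA.
  by have := no _ _ aA (fB _ aA); rewrite {1}e cats0 prefix_refl.
(* A point starting with [f a] and then [y] leaves the cone of [a]; the word of [A] covering it is
   nevertheless sent to [f a] too. *)
have [y yx] := other_letter d_gt1 x.
have [|a' a'A a'p] := (cAB (wcat (f a) (fun=> y))).2.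
  by exists (f a); [exact: fB|exact: in_cone_wcat].
have /orP[ab|ba] := in_cone_nested a'p (in_cone_wcat (f a) _).
  by have := no _ _ a'A (fB _ aA); rewrite ab.
have aa' : a' = a by apply: f_inj => //; exact: fE (fB _ aA) ba.
move: a'p; rewrite {}aa' {1}e => /in_coneP[q]; rewrite wcat_cat.
move=> /(congr1 (wdrop (size (f a)))); rewrite !wdrop_wcat.
by move=> /(congr1 (@^~ 0)) /= yE; rewrite yE eqxx in yx.
Qed.

End Codes.

(** * Flips of deep cones from finitely many short ones *)

Section Flips.
Context {d : nat} (d_gt1 : 1 < d).
Implicit Types (a b c e : word d) (p q : cantor d) (g : tree_aut d).
Implicit Types (h k : homeo (cantor d)).

Let letter0 : 'I_d := Ordinal (ltnW d_gt1).
Let letter1 : 'I_d := Ordinal d_gt1.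

(** A common point of the image cones would pull back under [k] to a common point of the original
    ones. *)
Lemma moves_flippable k a b a' b' : moves k a a' -> moves k b b' ->
  flippable a b -> flippable a' b'.
Proof.
move=> ka kb /orP[/eqP e|/negP ab]; rewrite /flippable.
  by rewrite -(moves_inj d_gt1 ka (c := b')) ?eqxx // e.
apply/orP; right; apply/negP => ab'; apply: ab.
have [p pa pb] : exists2 p, in_cone a' p & in_cone b' p.
  case/orP: ab' => [ab'|ba'].
    exists (wcat b' (fun=> letter0)); last exact: in_cone_wcat.
    by apply: in_cone_prefix ab' _; exact: in_cone_wcat.
  exists (wcat a' (fun=> letter0)); first exact: in_cone_wcat.
  by apply: in_cone_prefix ba' _; exact: in_cone_wcat.
move/moves_acts: ka => ka; move/moves_acts: kb => kb.
apply: (@in_cone_nested _ _ _ (k^-1%g p)).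
  by rewrite -(acts_in_cone _ ka) homeo_invgVK.
by rewrite -(acts_in_cone _ kb) homeo_invgVK.
Qed.

Variables (n : nat) (P : pred (word d)) (M : set (tree_aut d)).

(* [P] selects, by their length-[n] prefix, the words of a clopen region. The two
   extra letters provide at least four deep words of length [n.+2] in it, so that
   two of them can be avoided. *)
Definition deep a := (n.+2 <= size a) && P (take n a).

(** Only lengths [n.+2] and [n.+3] occur, so a finite [M] gives finitely many of these. *)
Definition short_flips : set (homeo (cantor d)) :=
  [set h | exists a b g, [/\ deep a, deep b, size a <= n.+3 /\ size b <= n.+3,
    flippable a b /\ M g & h = flip a b g]].

Hypothesis M1 : M 1%g.
Variable a0 : word d.
Hypotheses (size_a0 : size a0 = n) (Pa0 : P a0).

Lemma avoid_words u v : exists e, [/\ size e = n.+2, P (take n e), e != u & e != v].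
Proof.
(* Three distinct words below [a0], of which two forbidden words cannot exhaust all. *)
pose s := [:: a0 ++ [:: letter0; letter0]; a0 ++ [:: letter0; letter1];
           a0 ++ [:: letter1; letter0]].
have : ~~ all (mem [:: u; v]) s.
  have us : uniq s by rewrite /= !inE !eqseq_cat // !eqxx.
  by apply/negP => /allP /(uniq_leq_size us).
move=> /allPn[e es]; rewrite !inE negb_or => /andP[eu ev]; exists e.
by split=> //; move: es; rewrite !inE => /or3P[]/eqP->;
  rewrite ?size_cat ?size_a0 ?addn2 ?take_size_cat.
Qed.

Lemma prefix_eq a b : prefix a b -> size b <= size a -> a = b.
Proof.
move=> /prefixP[c ->]; rewrite size_cat -{2}[size a]addn0 leq_add2l leqn0.
by rewrite size_eq0 => /eqP->; rewrite cats0.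
Qed.

(* A flip involving a word longer than [n.+3] is conjugate, by a short flip moving
   the first [n.+3] letters of that word to a word of length [n.+2], to a flip of
   smaller total length. *)
Lemma flip_gen (T : set (homeo (cantor d))) a b g : is_subgroup T ->
  short_flips `<=` T -> deep a -> deep b -> flippable a b -> M g ->
  T (flip a b g).
Proof.
move=> Ts sT; have [N] := ubnP (size a + size b).
elim: N a b => // N IH a b abN da db ab Mg.
have [sab|] := boolP ((size a <= n.+3) && (size b <= n.+3)).
  by apply: sT; exists a, b, g; split=> //; apply/andP.
move=> long; have [w wab wlong] : exists2 w, w \in [:: a; b] & n.+3 < size w.
  move: long; rewrite negb_and -!ltnNge => /orP[]; first by exists a; rewrite ?mem_head.
  by exists b; rewrite // !inE eqxx orbT.
have deepab x : x \in [:: a; b] -> deep x by rewrite !inE => /orP[]/eqP ->.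
(* As [e] is a prefix of neither [a] nor [b], exchanging [c] and [e] shortens the words extending
   [c] and lengthens none. *)
have [e [se Pe ea eb]] := avoid_words (take n.+2 a) (take n.+2 b).
have eab x : x \in [:: a; b] -> ~~ prefix e x.
  by rewrite prefixE se eq_sym !inE => /orP[]/eqP ->.
pose c := take n.+3 w; have sc : size c = n.+3 by rewrite size_take wlong.
have cw : prefix c w by exact: prefix_take.
have ce : flippable c e.
  apply/orP; right; rewrite nested_sym; apply/negP => /prefix_nested ec.
  by have := eab w wab; rewrite (prefix_trans _ cw) ?ec // se sc.
have xc x : x \in [:: a; b] -> prefix x c -> x = c.
  move=> xab xc; have xw : x = w.
    have : nested x w by rewrite /nested (prefix_trans xc).
    move: ab xab wab; rewrite !inE => /orP[/eqP <-|].
      by rewrite orbb => /eqP-> /orP[]/eqP.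
    by move=> ab /orP[]/eqP-> /orP[]/eqP-> //; rewrite ?(negPf ab) //
      nested_sym (negPf ab).
  by move: (size_prefix xc); rewrite sc xw leqNgt wlong.
have xe x : x \in [:: a; b] -> prefix x e -> x = e.
  by move=> /deepab/andP[xn _] /prefix_eq -> //; rewrite se.
pose t := flip_word c e.
have tmoves x : x \in [:: a; b] -> moves (flip c e 1%g) x (t x).
  by move=> xab; apply: flip_word_moves => //; [exact: xc|exact: xe].
have tE x : x \in [:: a; b] -> t x = if prefix c x then e ++ drop (size c) x else x.
  by move=> xab; rewrite /t /flip_word (negPf (eab x xab)).
have st x : x \in [:: a; b] -> size (t x) <= size x - prefix c x.
  move=> xab; rewrite tE //; case: ifP => [cx|]; last by rewrite subn0.
  have := size_prefix cx; rewrite size_cat size_drop se sc => /subnKC {2}<-.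
  by rewrite addSn subn1.
have dt x : x \in [:: a; b] -> deep (t x).
  move=> xab; rewrite tE //; case: ifP => [cx|_]; last exact: deepab.
  by rewrite /deep size_cat se leq_addr takel_cat // se leqW.
have aab : a \in [:: a; b] by rewrite mem_head.
have bab : b \in [:: a; b] by rewrite !inE eqxx orbT.
have dc : deep c.
  have /andP[_] := deepab w wab.
  by rewrite /deep sc leqnSn /c take_takel // ltnW // ltnW.
have Tk : T (flip c e 1%g).
  apply: sT; exists c, e, 1%g; split=> //; last by rewrite sc se leqnn leqnSn.
  by rewrite /deep se leqnn.
have tab : flippable (t a) (t b).
  exact: moves_flippable (tmoves a aab) (tmoves b bab) ab.
rewrite (flip_conj d_gt1 g ab tab (movesV (tmoves a aab)) (movesV (tmoves b bab))).
apply: subgroupM => //; last by do 2!apply: subgroupV => //.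
apply: subgroupM => //; first exact: subgroupV.
apply: IH => //; [|exact: dt|exact: dt].
rewrite -ltnS; apply: leq_ltn_trans abN.
have tw : size (t w) < size w.
  by apply: leq_ltn_trans (st w wab) _; rewrite cw subn1 ltn_predL (leq_trans _ wlong).
have tle x : x \in [:: a; b] -> size (t x) <= size x.
  by move=> /st /leq_trans -> //; exact: leq_subr.
move: wab; rewrite !inE => /orP[]/eqP wE; rewrite wE in tw.
  by rewrite -addSn leq_add // tle.
by rewrite -addnS leq_add // tle.
Qed.


End Flips.

(** * Homeomorphisms given by tables of cones are products of flips *)

Section Decomposition.
Context {d : nat} (d_gt1 : 1 < d).
Implicit Types (a b c e : word d) (p q : cantor d) (g : tree_aut d).
Implicit Types (h k : homeo (cantor d)) (s : seq (word d * word d)).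

Let letter0 : 'I_d := Ordinal (ltnW d_gt1).

Variables (n : nat) (P : pred (word d)) (M : set (tree_aut d)).
Variable T : set (homeo (cantor d)).
Hypothesis M1 : M 1%g.
Hypothesis T_subgroup : is_subgroup T.
Hypothesis T_flip : forall a b g, deep n P a -> deep n P b -> flippable a b ->
  M g -> T (flip a b g).

(** The first words form the code A and the second words the code B; the properties of B are derived
    from the bijectivity of [h]. *)
Definition presents s h :=
  [/\ uniq (unzip1 s), antichain (unzip1 s),
    forall p, ~ covers (unzip1 s) p -> h p = p &
    forall x, x \in s -> [/\ deep n P x.1, deep n P x.2 &
      exists2 g, M g & acts h x.1 x.2 g]].

Section Presentation.
Variables (s : seq (word d * word d)) (h : homeo (cantor d)).
Hypothesis hs : presents s h.

Lemma presents_acts x : x \in s -> exists2 g, M g & acts h x.1 x.2 g.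
Proof. by case: hs => _ _ _ H /H[]. Qed.

(** Nested target cones share a point, whose preimage lies in both source cones; these are disjoint
    unless they coincide. *)
Lemma presents_prefix x y : x \in s -> y \in s -> prefix x.2 y.2 -> x = y.
Proof.
have [us as_ _ _] := hs => xs ys /prefixP[c e].
have [g Mg hx] := presents_acts xs; have [g' Mg' hy] := presents_acts ys.
apply: (uniq_map_inj us) => //.
apply: (antichain_nested as_); rewrite ?map_f //.
apply: (@in_cone_nested _ _ _ (wcat y.1 (fun=> letter0))).
  by rewrite -(acts_in_cone _ hx) hy e wcat_cat in_cone_wcat.
exact: in_cone_wcat.
Qed.

Lemma presents_nested x y : x \in s -> y \in s -> nested x.2 y.2 -> x = y.
Proof.
by move=> xs ys /orP[/(presents_prefix xs ys)|/(presents_prefix ys xs)].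
Qed.

Lemma presents_uniq2 : uniq (unzip2 s).
Proof.
have [/map_uniq us _ _ _] := hs; rewrite map_inj_in_uniq // => x y xs ys e.
by apply: presents_prefix => //; rewrite e prefix_refl.
Qed.

Lemma presents_antichain2 : antichain (unzip2 s).
Proof.
by move=> _ _ /mapP[x xs ->] /mapP[y ys ->] /presents_prefix->.
Qed.

(** A bijection that is the identity off the region covered by A preserves this region. *)
Lemma presents_covers p : covers (unzip1 s) p <-> covers (unzip2 s) p.
Proof.
have [_ _ hid _] := hs; split=> -[_ /mapP[x xs ->] px].
  apply: contrapT => np.
  have /hid : ~ covers (unzip1 s) (h^-1%g p).
    move=> [_ /mapP[y ys ->] py]; apply: np; exists y.2; first exact: map_f.
    have [g _ hy] := presents_acts ys.
    by rewrite -(homeo_invgVK h p) (acts_in_cone _ hy).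
  rewrite homeo_invgVK => e; have [g _ hx] := presents_acts xs.
  apply: np; exists x.2; first exact: map_f.
  by rewrite -(homeo_invgVK h p) -e (acts_in_cone _ hx).
apply: contrapT => np; apply: (np); exists x.1; first exact: map_f.
have [g _ hx] := presents_acts xs.
by rewrite -(acts_in_cone _ hx) hid.
Qed.

(** The two flipped cones lie in the covered region, so the product is still the identity off it;
    the prefix conditions ensure that no target cone is split by the flip. *)
Lemma presents_flip c e : deep n P c -> deep n P e -> flippable c e ->
  (forall p, in_cone c p || in_cone e p -> covers (unzip1 s) p) ->
  (forall b, b \in unzip2 s -> prefix b c -> b = c) ->
  (forall b, b \in unzip2 s -> prefix b e -> b = e) ->
  presents [seq (x.1, flip_word c e x.2) | x <- s] (flip c e 1 * h)%g.
Proof.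
move=> dc de ce region bc be; have [us as_ hid hs'] := hs.
have s1 : unzip1 [seq (x.1, flip_word c e x.2) | x <- s] = unzip1 s.
  by rewrite /unzip1 -map_comp.
rewrite /presents s1; split=> // [p np|_ /mapP[x xs ->] /=].
  rewrite homeoME hid // flip_id //.
    by apply/negP => cp; apply: np; apply: region; rewrite cp.
  by apply/negP => ep; apply: np; apply: region; rewrite ep orbT.
have [dx1 dx2 [g Mg hx]] := hs' x xs; split=> //.
  have deep_cat w w' : deep n P w -> deep n P (w ++ w').
    move=> /andP[sw Pw]; rewrite /deep size_cat (leq_trans sw (leq_addr _ _)).
    by rewrite takel_cat // (leq_trans _ sw) // ltnW.
  by rewrite /flip_word; do 2?case: ifP => _ //; exact: deep_cat.
exists g => //; apply: acts_moves hx _.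
by apply: flip_word_moves => //; [apply: bc|apply: be]; exact: map_f.
Qed.

(** Dividing by the action of [g] on the cone of [a] makes the homeomorphism trivial there. The
    other entries survive because their target cones are disjoint from that of [a]. *)
Lemma presents_rem a : (a, a) \in s -> exists2 g, M g &
  presents (rem (a, a) s) ((flip a a g)^-1 * h)%g.
Proof.
move=> as_; have [us anti hid hs'] := hs.
have [da _ [g Mg ha]] := hs' _ as_; exists g => //.
have aa := flippable_refl a; have [fa _ _] := flipP g aa.
have fV p : ~~ in_cone a p -> (flip a a g)^-1%g p = p.
  by move=> ap; rewrite -{1}(flip_id g aa ap ap) homeo_invgK.
have sub x : x \in rem (a, a) s -> x \in s by exact: mem_rem.
split.
- by apply: subseq_uniq us; exact: map_subseq (rem_subseq _ _).
- by move=> _ _ /mapP[x /sub xs ->] /mapP[y /sub ys ->]; apply: anti; exact: map_f.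
- move=> p np; rewrite homeoME.
  have [/in_coneP[q ->]|ap] := boolP (in_cone a p).
    by rewrite ha -fa homeo_invgK.
  rewrite hid ?fV // => -[_ /mapP[x xs ->] px]; apply: np; exists x.1 => //.
  apply: map_f; move: xs; rewrite (perm_mem (perm_to_rem as_)) inE.
  by move=> /predU1P[xE|//]; move: px; rewrite xE /= (negPf ap).
- move=> x xs; have [d1 d2 [g' Mg' hx]] := hs' x (sub x xs); split=> //.
  exists g' => // p; rewrite homeoME hx fV //.
  apply/negP => /in_cone_nested/(_ (in_cone_wcat _ _)).
  move=> /(presents_nested as_ (sub x xs)) xE.
  by move: xs; rewrite -xE mem_rem_uniq ?inE ?eqxx //; exact: map_uniq us.
Qed.

End Presentation.

Lemma presents_gen s h : presents s h -> T h.
Proof.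
have [N] := ubnP (size s); elim: N s h => // N IH s h; rewrite ltnS => sN hs.
have Tdiv k f : T f -> T (f * k)%g -> T k.
  by move=> Tf; rewrite -{2}(mulKg f k); apply: subgroupM => //; exact: subgroupV.
have fixed t k a : size t <= size s -> presents t k -> (a, a) \in t -> T k.
  move=> ts kt at_; have [g Mg kt'] := presents_rem kt at_.
  have [_ _ _ /(_ _ at_)[da _ _]] := kt.
  apply: (Tdiv _ (flip a a g)^-1%g).
    by apply: subgroupV => //; apply: T_flip => //; exact: flippable_refl.
  apply: IH kt'; rewrite size_rem // (leq_trans _ (leq_trans ts sN)) //.
  by rewrite ltn_predL; case: (t) at_.
have anti b b' : prefix b b' -> prefix b' b -> b = b'.
  by move=> bb' /size_prefix; exact: prefix_eq.
(* Flipping [x.2] with [y.2 = x.1] turns the entry [x] into [(x.1, x.1)], to which [fixed]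
   applies. *)
have shared t k x y : size t <= size s -> presents t k -> x \in t -> y \in t ->
    x.1 = y.2 -> T k.
  move=> ts kt xt yt xy; have [xy'|/eqP nxy] := eqVneq x y.
    by apply: (fixed t k x.1) => //; rewrite {2}xy -xy' -surjective_pairing.
  have [_ _ _ kt'] := kt; have [[_ dx _] [_ dy _]] := (kt' x xt, kt' y yt).
  have fxy : flippable x.2 y.2.
    by apply/orP; right; apply/negP => /(presents_nested kt xt yt).
  apply: (Tdiv _ (flip x.2 y.2 1%g)); first exact: T_flip.
  apply: (fixed [seq (z.1, flip_word x.2 y.2 z.2) | z <- t] _ y.2).
  - by rewrite size_map.
  - apply: presents_flip => //.
    + move=> p xyp; apply/(presents_covers kt).
      by case/orP: xyp => zp; [exists x.2|exists y.2] => //; exact: map_f.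
    + move=> b bt; exact: (presents_antichain2 kt bt (map_f snd xt)).
    + move=> b bt; exact: (presents_antichain2 kt bt (map_f snd yt)).
  - apply/mapP; exists x => //.
    by rewrite -xy /flip_word prefix_refl drop_size cats0 xy.
have [us as_ hid hs'] := hs.
have [s0|s0] := eqVneq s [::].
  have -> : h = 1%g by apply: homeo_ext => p; rewrite hid // s0 => -[].
  exact: subgroup1.
have u0 : unzip1 s != [::] by case: (s) s0.
have v0 : unzip2 s != [::] by case: (s) s0.
have usz : size (unzip1 s) = size (unzip2 s) by rewrite !size_map.
have [a0 aA [b0 bB ab]] := codes_refine d_gt1 us (presents_uniq2 hs) as_
  (presents_antichain2 hs) usz (presents_covers hs) u0.
have [b1 bB' [a1 aA' ba]] := codes_refine d_gt1 (presents_uniq2 hs) us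
  (presents_antichain2 hs) as_ (esym usz) (fun p => iff_sym (presents_covers hs p)) v0.
have [eab|/eqP nab] := eqVneq a0 b0.
  move/mapP: aA bB => [x xs xE] /mapP[y ys yE].
  by apply: (shared s h x y) => //; rewrite -xE -yE.
have [eba|/eqP nba] := eqVneq a1 b1.
  move/mapP: aA' bB' => [x xs xE] /mapP[y ys yE].
  by apply: (shared s h x y) => //; rewrite -xE -yE.
(* If [b1] is a prefix of [a0], hence of [b0], then [b1 = b0] in the antichain B and [a0 = b0]. If
   [a0] is a prefix of [b1], hence of [a1], then likewise [a0 = a1] and [a1 = b1]. *)
have fba : flippable b1 a0.
  apply/orP; right; apply/negP => /orP[b1a0|a0b1].
    have b10 := presents_antichain2 hs bB' bB (prefix_trans b1a0 ab).
    by apply: nab; apply: anti; rewrite // -b10.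
  have a01 := as_ _ _ aA aA' (prefix_trans a0b1 ba).
  by apply: nba; apply: anti; rewrite // -a01.
have da : deep n P a0 by have /mapP[x /hs'[? _ _] ->] := aA.
have db : deep n P b1 by have /mapP[x /hs'[_ ? _] ->] := bB'.
apply: (Tdiv _ (flip b1 a0 1%g)); first exact: T_flip.
have /mapP[z zs zE] := bB'; have /mapP[x xs xE] := aA.
(* After the flip, the entry whose target was [b1] has target [a0], which is the source of [x]. *)
apply: (shared [seq (w.1, flip_word b1 a0 w.2) | w <- s] _
  (x.1, flip_word b1 a0 x.2) (z.1, flip_word b1 a0 z.2)).
- by rewrite size_map.
- apply: presents_flip => // [p|b bs|b bs ba0].
  + by case/orP=> ?; [apply/(presents_covers hs); exists b1|exists a0].
  + exact: (presents_antichain2 hs bs bB').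
  + have bb0 := presents_antichain2 hs bs bB (prefix_trans ba0 ab).
    by case: nab; apply: anti => //; rewrite -bb0.
- by apply/mapP; exists x.
- by apply/mapP; exists z.
- by rewrite /= -zE -xE /flip_word prefix_refl drop_size cats0.
Qed.

End Decomposition.

(** * Compactness of the Cantor space, as uniform depth *)

Section Compactness.
Context {d : nat}.

(** If no depth works at the root, then at each bad word some child is bad. Following bad children
    gives a point that contradicts the hypothesis. *)
Lemma konig (d_gt1 : 1 < d) (Q : word d -> Prop) :
  (forall p : cantor d, exists n m, forall c, m <= size c -> Q (wprefix p n ++ c)) ->
  exists m, forall c, m <= size c -> Q c.
Proof.
pose U a := exists m, forall c, m <= size c -> Q (a ++ c).
move=> QP; apply: contrapT => nU0.
have step a : exists x, ~ U a -> ~ U (rcons a x).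
  have [Ua|nUa] := pselect (U a); first by exists (Ordinal d_gt1).
  apply: contrapT => /forallNP nx; apply: nUa.
  have [m mP] : {m : 'I_d -> nat & forall x c, m x <= size c -> Q (rcons a x ++ c)}.
    apply: (@choice _ _ (fun x m => forall c, m <= size c -> Q (rcons a x ++ c))) => x.
    apply: contrapT => nUx.
    by apply: (nx x).
  (* The largest bound among the finitely many children serves the parent, with one more letter to
     reach the child. *)
  exists (\max_x m x).+1 => -[//|x c]; rewrite ltnS -cat_rcons => xc.
  by apply: mP; apply: leq_trans xc; exact: leq_bigmax.
have [f fP] := choice step.
pose path n := iter n (fun a => rcons a (f a)) [::].
pose p : cantor d := fun n => f (path n).
have pE n : wprefix p n = path n by elim: n => // n IH; rewrite wprefixS IH.
have nU n : ~ U (path n) by elim: n => [//|n /fP].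
by have [n [m H]] := QP p; apply: (nU n); exists m; rewrite -pE.
Qed.

Lemma finite_words_bounded (A : set (word d)) : finite_set A ->
  exists m, forall a, A a -> size a < m.
Proof.
case/finite_seqP=> s ->; exists (\max_(a <- s) size a).+1 => a /= as_.
by rewrite ltnS; exact: (@leq_bigmax_seq _ _ xpredT size).
Qed.

End Compactness.

(** * Röver-Nekrashevych elements at uniform depth *)

Section RoverNekrashevych.
Context {d : nat} (d_gt1 : 1 < d).
Implicit Types (a b c e : word d) (p q : cantor d) (g : tree_aut d).
Implicit Types (h k : homeo (cantor d)).

Variables (G M : set (tree_aut d)).
Hypothesis G_subgroup : is_subgroup G.
Hypothesis G_self_similar : self_similar G.
Hypothesis sMG : M `<=` G.
Hypothesis G_to_M : forall g, G g -> exists m, forall a, m <= size a ->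
  M (local_action g a).

Let RN := rover_nekrashevych G.

(** Below a cone with local action in [G], going deeper brings the local action into [M] and makes
    the target as long as desired; compactness makes the depth uniform. *)
Lemma rn_uniform h m : RN h -> exists n, forall a, n <= size a ->
  exists b g, [/\ m <= size b, M g & acts h a b g].
Proof.
move=> hRN; apply: (konig d_gt1) => p.
have [a pa [b _ [g Gg hab]]] := hRN p.
have {}pa : in_cone a p by apply/in_coneP; case: pa => q _ <-; exists q.
have [n nP] := G_to_M Gg; exists (size a), (maxn m n) => c.
rewrite (eqP pa) geq_max => /andP[mc nc].
exists (b ++ g c), (local_action g c); split; last exact: acts_cat.
  by rewrite size_cat size_aut (leq_trans mc) // leq_addl.
exact: nP.
Qed.

Lemma rn_of_uniform h n : (forall a, size a = n ->
  exists b g, G g /\ acts h a b g) -> RN h.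
Proof.
move=> hn p; have [b [g [Gg hab]]] := hn _ (size_wprefix p n).
exists (wprefix p n); first by exists (wdrop n p); rewrite ?wcat_wdrop.
by exists b; [exact: acts_image hab|exists g].
Qed.

Lemma rn_subgroup : is_subgroup RN.
Proof.
apply/is_subgroupP; split=> [|h k hRN kRN].
  apply: (@rn_of_uniform _ 0) => a _; exists a, 1%g; split; first exact: subgroup1.
  by apply/moves_acts.
have kV : RN k^-1%g.
  move=> p; have [a pa [b kab [g Gg kact]]] := kRN (k^-1%g p).
  exists b; first by rewrite -kab; exists (k^-1%g p); rewrite // homeo_invgVK.
  have kV := actsV kact; exists a; first exact: acts_image kV.
  by exists g^-1%g => //; exact: subgroupV.
(* The targets of [k^-1] are taken of length at least [n], where [h] acts on every cone. *)
have [n hn] := rn_uniform 0 hRN; have [m km] := rn_uniform n kV.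
apply: (@rn_of_uniform _ m) => a am.
have [|b [g [bn Mg kab]]] := km a; first by rewrite am.
have [c [g' [_ Mg' hbc]]] := hn b bn.
exists c, (g' * g)%g; split; last exact: actsM kab hbc.
by apply: subgroupM => //; exact: sMG.
Qed.

Lemma rn_flip a b g : flippable a b -> G g -> RN (flip a b g).
Proof.
move=> ab Gg; have [fa fb fid] := flipP g ab.
have nin c w p : ~~ prefix c w -> size c <= size w -> ~~ in_cone c (wcat w p).
  move=> cw cs; apply/negP => /in_cone_nested/(_ (in_cone_wcat w p)).
  by move=> /prefix_nested/(_ cs); rewrite (negPf cw).
(* At this depth a word extends [a], extends [b], or has a cone disjoint from both. *)
apply: (@rn_of_uniform _ (size a + size b)) => w sw.
have [/prefixP[c ->]|aw] := boolP (prefix a w).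
  exists (b ++ g c), (local_action g c).
  by split; [exact: G_self_similar|exact: acts_cat].
have [bw|bw] := boolP (prefix b w).
  have nab : a <> b by move=> ab'; move: aw; rewrite ab' bw.
  have /prefixP[c ->] := bw; exists (a ++ g^-1%g c), (local_action g^-1%g c).
  split; last exact: acts_cat (fb nab).
  by apply: G_self_similar; exact: subgroupV.
exists w, 1%g; split; first exact: subgroup1.
by apply/moves_acts => p; rewrite fid // nin // sw ?leq_addr ?leq_addl.
Qed.

Variables (n : nat) (P : pred (word d)) (T : set (homeo (cantor d))).
Hypothesis M1 : M 1%g.
Hypothesis T_subgroup : is_subgroup T.
Variable a0 : word d.
Hypotheses (size_a0 : size a0 = n) (Pa0 : P a0).
Hypothesis T_flips : short_flips n P M `<=` T.

Lemma wprefix_wcat_take a p m : m <= size a -> wprefix (wcat a p) m = take m a.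
Proof.
move=> ma; have := wprefix_wcat_size (take m a) (wcat (drop m a) p).
by rewrite size_takel // -wcat_cat cat_take_drop.
Qed.

Lemma rn_supported_gen h : RN h ->
  (forall p, ~~ P (wprefix p n) -> h p = p) -> T h.
Proof.
move=> hRN hid; have [m hm] := rn_uniform n.+2 hRN.
pose L := maxn m n.+2.
have [f fP] : {f : word d -> word d & forall a, L <= size a ->
    n.+2 <= size (f a) /\ exists2 g, M g & acts h a (f a) g}.
  apply: (@choice _ _ (fun a b => L <= size a ->
    n.+2 <= size b /\ exists2 g, M g & acts h a b g)) => a.
  have [La|] := leqP L (size a); last by exists [::].
  have [|b [g [sb Mg hab]]] := hm a; first by rewrite (leq_trans _ La) ?leq_maxl.
  by exists b => _; split=> //; exists g.
(* The code A: all words of length [L] in the region. The bound [n.+2 <= L] makes them deep. *)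
pose W := [seq w <- [seq tval t | t <- enum {: L.-tuple 'I_d}] | P (take n w)].
have WP w : w \in W = (size w == L) && P (take n w).
  rewrite mem_filter andbC; congr (_ && _); apply/mapP/eqP => [[t _ ->]|/eqP sw].
    by rewrite size_tuple.
  by exists (Tuple sw); rewrite // mem_enum.
have nL : n <= L by rewrite /L (leq_trans _ (leq_maxr _ _)) // ltnW.
have s1 : unzip1 [seq (w, f w) | w <- W] = W.
  by rewrite /unzip1 -map_comp map_id.
have Tf a b g : deep n P a -> deep n P b -> flippable a b -> M g -> T (flip a b g).
  exact: (flip_gen d_gt1 M1 size_a0 Pa0 T_subgroup T_flips).
apply: (presents_gen d_gt1 M1 T_subgroup Tf (s := [seq (w, f w) | w <- W])).
rewrite /presents s1; split.
- by rewrite filter_uniq // map_inj_uniq ?enum_uniq //; exact: val_inj.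
- move=> w w'; rewrite !WP => /andP[/eqP sw _] /andP[/eqP sw' _] ww'.
  by apply: prefix_eq ww' _; rewrite sw sw'.
- move=> p np; apply: hid; apply/negP => Pp; apply: np.
  exists (wprefix p L); last exact: in_cone_wprefix.
  by rewrite WP size_wprefix eqxx -(subnKC nL) wprefixD take_cat size_wprefix
    ltnn subnn take0 cats0.
- move=> _ /mapP[w + ->]; rewrite WP => /andP[/eqP sw Pw] /=.
  have [|sf [g Mg hw]] := fP w; first by rewrite sw.
  split=> //; last by exists g.
    by rewrite /deep sw leq_maxr Pw.
  (* If the target word left the region, [h p] would be fixed by [h]; injectivity would give
     [h p = p], which lies in the region. *)
  rewrite /deep sf /=; apply: contraT => nP.
  pose p := wcat w (fun=> Ordinal d_gt1).
  have hp : h (h p) = h p.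
    by apply: hid; rewrite hw wprefix_wcat_take // (leq_trans _ sf) // ltnW.
  have := hid (h p); rewrite hp.
  have pP : P (wprefix p n) by rewrite wprefix_wcat_take // sw.
  move: nP; rewrite -(wprefix_wcat_take (boundary g (fun=> Ordinal d_gt1))).
    by rewrite -hw (homeo_inj hp) pP.
  by rewrite (leq_trans _ sf) // ltnW.
Qed.

End RoverNekrashevych.

(** * Finiteness of bounded lists, and eventual properties *)

Lemma finite_bounded_seq (T : eqType) (E : set T) n : finite_set E ->
  finite_set [set s : seq T | size s <= n /\ forall x, x \in s -> E x].
Proof.
move=> finE; elim: n => [|n IH].
  apply: sub_finite_set (finite_set1 [::]) => s [].
  by rewrite leqn0 size_eq0 => /eqP.
have finS := finite_image2 cons finE IH.
have : finite_set ([set [::]] `|` [set x :: s | x in E & s in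
    [set s : seq T | size s <= n /\ forall x, x \in s -> E x]]).
  by rewrite finite_setU; split=> //; exact: finite_set1.
apply: sub_finite_set.
move=> [|x s] [sn sE]; [by left|right].
exists x; first by apply: sE; rewrite mem_head.
by exists s => //; split=> // y ys; apply: sE; rewrite inE ys orbT.
Qed.

Lemma finite_short_words d n : finite_set [set a : word d | size a <= n].
Proof.
apply: sub_finite_set (finite_bounded_seq n (@finite_finset _ [set: 'I_d])).
by move=> a an; split.
Qed.

Lemma eventually_seq (T : eqType) (s : seq T) (Q : T -> nat -> Prop) :
  (forall x, x \in s -> exists m, forall n, m <= n -> Q x n) ->
  exists m, forall x n, x \in s -> m <= n -> Q x n.
Proof.
elim: s => [|x s IH] H; first by exists 0.
have [|m mP] := IH; first by move=> y ys; apply: H; rewrite inE ys orbT.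
have [m' m'P] := H x (mem_head x s); exists (maxn m m') => y n.
by rewrite inE geq_max => /predU1P[->|ys] /andP[];
  [move=> _; exact: m'P|move=> + _; exact: mP].
Qed.

(** * Eventual periodicity and separation of rational points *)

Section RationalPoints.
Context {d : nat} (d_gt1 : 1 < d).
Implicit Types (p q : cantor d) (s : seq (cantor d)).

Let letter0 : 'I_d := Ordinal (ltnW d_gt1).
Let letter1 : 'I_d := Ordinal d_gt1.

Lemma wdrop_period p n m k :
  wdrop (n + m) p = wdrop n p -> wdrop (n + k * m) p = wdrop n p.
Proof.
move=> H; elim: k => [|k IH]; first by rewrite addn0.
by rewrite mulSn addnA -wdropD H wdropD.
Qed.

Lemma rational_period p : rational p -> exists2 m, 0 < m &
  exists n0, forall n, n0 <= n -> wdrop (n + m) p = wdrop n p.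
Proof.
move=> [a [x [b ->]]]; exists (size b).+1 => //; exists (size a) => n.
move=> /subnKC <-; rewrite -addnA -!(wdropD (size a)) wdrop_wcat.
by apply/funext => k; rewrite /wdrop /periodic addnAC modnDr.
Qed.

(** The product of the individual periods is a period of every point. *)
Lemma common_period s : (forall p, p \in s -> rational p) -> exists2 m, 0 < m &
  forall p, p \in s -> exists n0, forall n, n0 <= n -> wdrop (n + m) p = wdrop n p.
Proof.
elim: s => [|p s IH] H; first by exists 1.
have [|m m0 mP] := IH; first by move=> q qs; apply: H; rewrite inE qs orbT.
have [m' m'0 [n0 n0P]] := rational_period (H p (mem_head p s)).
exists (m * m'); first by rewrite muln_gt0 m0.
move=> q; rewrite inE => /predU1P[->|/mP[n1 n1P]].
  by exists n0 => n /n0P; exact: wdrop_period.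
by exists n1 => n /n1P; rewrite mulnC; exact: wdrop_period.
Qed.

Lemma wprefix_separates p q : p <> q ->
  exists n0, forall n, n0 <= n -> wprefix p n <> wprefix q n.
Proof.
move=> pq; apply: contrapT => /forallNP H; apply: pq; apply: wprefix_inj => n.
apply: contrapT => npq; apply: (H n) => m nm e.
exact: npq (eq_wprefix e nm).
Qed.

(** Diagonal argument: [q] differs from the point of index [i] at its letter [i]. *)
Lemma avoid_points s : exists q, q \notin s.
Proof.
pose q : cantor d :=
  fun n => if nth (fun=> letter0) s n n == letter0 then letter1 else letter0.
exists q; apply/negP => qs; have := nth_index (fun=> letter0) qs.
move=> /(congr1 (@^~ (index q s))); rewrite {3}/q.
by case: eqP => [->|//].
Qed.

(** Each requirement holds from some level on, so the maximum of three levels serves; [a0] is a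
    prefix of a point outside [s]. *)
Lemma level_ex s : (forall p, p \in s -> rational p) ->
  exists n m a0, [/\ 0 < m, size a0 = n, a0 \notin [seq wprefix p n | p <- s],
    {in s &, injective (wprefix^~ n)} &
    forall p, p \in s -> wdrop (n + m) p = wdrop n p].
Proof.
move=> s_rat; have [m m0 /eventually_seq[n1 n1P]] := common_period s_rat.
have [q qs] := avoid_points s.
have sep r : exists n2, forall p n, p \in s -> n2 <= n ->
    wprefix p n = wprefix r n -> p = r.
  apply: (@eventually_seq _ s (fun p n => wprefix p n = wprefix r n -> p = r)) => p ps.
  have [->|/eqP/wprefix_separates[n2 n2P]] := eqVneq p r; first by exists 0.
  by exists n2 => n /n2P.
have [n2 n2P] := sep q.
have [n3 n3P] : exists n3, forall r n, r \in s -> n3 <= n ->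
    forall p, p \in s -> wprefix p n = wprefix r n -> p = r.
  apply: (@eventually_seq _ s (fun r n => forall p, p \in s ->
    wprefix p n = wprefix r n -> p = r)) => r _.
  by have [n3 H] := sep r; exists n3 => n n3n p ps; exact: H.
pose n := maxn n1 (maxn n2 n3); exists n, m, (wprefix q n); split=> //.
- exact: size_wprefix.
- apply/mapP => -[p ps] /esym/(n2P p n ps) pq; move: qs; rewrite -pq ?ps //.
  by rewrite /n leq_max leq_maxl orbT.
- by move=> p r ps rs; apply: n3P => //; rewrite /n !leq_max leqnn !orbT.
- by move=> p ps; apply: n1P => //; exact: leq_maxl.
Qed.

End RationalPoints.

(** * Contractions, germs and generators of the stabilizer *)

Section Stabilizer.
Context {d : nat} (d_gt1 : 1 < d).
Implicit Types (a b c e : word d) (p q : cantor d) (g : tree_aut d).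
Implicit Types (h k : homeo (cantor d)).

Lemma image_stableP (S : set (cantor d)) h :
  h @` S = S <-> forall p, S (h p) <-> S p.
Proof.
split=> [hS p|hS]; last first.
  apply/seteqP; split=> [_ [p Sp <-]|p Sp]; first exact/hS.
  by exists (h^-1%g p); [apply/hS; rewrite homeo_invgVK|exact: homeo_invgVK].
split=> [|Sp]; last by rewrite -hS; exists p.
by rewrite -{1}hS => -[q Sq /(@homeo_inj d) <-].
Qed.

Lemma stabilizer_subgroup (H : set (homeo (cantor d))) (S : set (cantor d)) :
  is_subgroup H -> is_subgroup (setwise_stabilizer H S).
Proof.
move=> Hs; apply/is_subgroupP; split.
  by split; [exact: subgroup1|apply/image_stableP].
move=> h k [Hh /image_stableP hS] [Hk /image_stableP kS]; split.
  by apply: subgroupM => //; exact: subgroupV.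
apply/image_stableP => p; rewrite homeoME hS.
by rewrite -[X in _ <-> S X](homeo_invgVK k p) kS.
Qed.

Variables (G M : set (tree_aut d)).
Hypothesis G_subgroup : is_subgroup G.
Hypothesis G_self_similar : self_similar G.
Hypothesis sMG : M `<=` G.
Hypothesis M1 : M 1%g.
Hypothesis M_finite : finite_set M.
Hypothesis G_to_M : forall g, G g -> exists m, forall a, m <= size a ->
  M (local_action g a).

Variables (s : seq (cantor d)) (n m : nat) (a0 : word d).
Hypotheses (m_gt0 : 0 < m) (size_a0 : size a0 = n).
Hypothesis a0_notin : a0 \notin [seq wprefix p n | p <- s].
Hypothesis wprefix_s_inj : {in s &, injective (fun p => wprefix p n)}.
Hypothesis period_s : forall p, p \in s -> wdrop (n + m) p = wdrop n p.

Let RN := rover_nekrashevych G.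
Let H := setwise_stabilizer RN [set` s].
Let P : pred (word d) := fun w => w \notin [seq wprefix p n | p <- s].

Let RNs : is_subgroup RN := rn_subgroup d_gt1 G_subgroup sMG G_to_M.
Let Hs : is_subgroup H := stabilizer_subgroup [set` s] RNs.

Let wprefix_mem p : p \in s -> wprefix p n \in [seq wprefix p n | p <- s].
Proof. by move=> ps; apply/mapP; exists p. Qed.

Let a0_neq p : p \in s -> wprefix p n <> a0.
Proof. by move=> /wprefix_mem pm e; move: a0_notin; rewrite -e pm. Qed.

(* Shifts the cone of the first [n] letters of [p] to that of the first [n + m],
   hence fixes [p], whose tails at [n] and [n + m] agree. *)
Definition contraction p : homeo (cantor d) :=
  (flip a0 (wprefix p (n + m)) 1 * flip (wprefix p n) a0 1)%g.

Section Contraction.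
Variable p : cantor d.
Hypothesis ps : p \in s.

Let flippable1 : flippable (wprefix p n) a0.
Proof.
apply/orP; right; apply/negP => /prefix_nested.
rewrite size_wprefix size_a0 => /(_ (leqnn n))/prefix_eq e.
by apply: (a0_neq ps); apply: e; rewrite size_wprefix size_a0.
Qed.

Let flippable2 : flippable a0 (wprefix p (n + m)).
Proof.
apply/orP; right; apply/negP => /prefix_nested.
rewrite size_wprefix size_a0 => /(_ (leq_addr _ _)) a0p.
have /eqP := in_cone_prefix a0p (in_cone_wprefix p (n + m)).
by rewrite size_a0; exact: a0_neq.
Qed.

Lemma contraction_moves : moves (contraction p) (wprefix p n) (wprefix p (n + m)).
Proof. exact: movesM (flip_movesl flippable1) (flip_movesl flippable2). Qed.

Lemma contraction_id q : ~~ in_cone (wprefix p n) q -> ~~ in_cone a0 q ->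
  contraction p q = q.
Proof.
move=> pq aq; rewrite homeoME !flip_id //.
by apply: contra pq; apply: in_cone_prefix; rewrite wprefixD prefix_prefix.
Qed.

(** At level [n], the cone at [q] is disjoint from those of [p] and [a0]. Hence the contraction at
    [p] leaves the germ at [q] unchanged. *)
Lemma contraction_id_cone q r : q \in s -> q <> p ->
  contraction p (wcat (wprefix q n) r) = wcat (wprefix q n) r.
Proof.
move=> qs qp.
have nin a : size a = n -> in_cone a (wcat (wprefix q n) r) -> a = wprefix q n.
  move=> an ar; apply: (in_cone_size ar (in_cone_wcat _ _)).
  by rewrite an size_wprefix.
apply: contraction_id; apply/negP => /nin.
  by rewrite size_wprefix => /(_ erefl)/wprefix_s_inj e; apply: qp; rewrite e.
by move=> /(_ size_a0) e; apply: (a0_neq qs).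
Qed.

Lemma contraction_fixes q : q \in s -> contraction p q = q.
Proof.
move=> qs; rewrite -(wcat_wdrop q n); have [->|/eqP qp] := eqVneq q p.
  by rewrite contraction_moves // -{1}(period_s ps) !wcat_wdrop.
exact: contraction_id_cone.
Qed.

Lemma contraction_stabilizes : H (contraction p).
Proof.
have G1 := subgroup1 G_subgroup.
split; first by apply: (subgroupM RNs); exact: (rn_flip G_subgroup G_self_similar).
apply/image_stableP => q; split=> qs; last by rewrite (contraction_fixes qs).
by rewrite -(homeo_inj (contraction_fixes qs)).
Qed.

(** By periodicity the [m] letters of [p] after position [n + k * m] are those after [n], so each
    further factor appends one more period. *)
Lemma contractionX_moves (k : nat) :
  moves (contraction p ^+ k)%g (wprefix p n) (wprefix p (n + k * m)).
Proof.
elim: k => [|k IH]; first by rewrite addn0.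
rewrite expgSr mulSn addnA [n + m + _]addnAC [X in moves _ _ X]wprefixD.
rewrite (wdrop_period _ (period_s ps)); apply: movesM contraction_moves _.
by rewrite wprefixD; exact: moves_cat.
Qed.

Lemma contractionX_id (k : nat) q : contraction p q = q -> (contraction p ^+ k)%g q = q.
Proof. by move=> e; elim: k => [//|k IH]; rewrite expgSr homeoME e. Qed.

End Contraction.

(** For finite [M] the upper bound leaves finitely many germs at [p]. The lower bound keeps the
    image inside the level-[n] cone of [h p], where contractions at other points are trivial. *)
Definition tame p h := exists b g,
  [/\ n <= size b <= n + m, M g & acts h (wprefix p n) b g].

Lemma acts_wprefix h a b g p : in_cone a p -> acts h a b g ->
  b = wprefix (h p) (size b).
Proof. by move=> ap hab; apply/esym/eqP; have := acts_in_cone p hab; rewrite ap. Qed.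

Lemma tameX h p (k l : nat) : H h -> p \in s -> (h p) \in s ->
  forall q, q \in s -> q <> p -> tame q h ->
  tame q (contraction (h p) ^- l * h * contraction p ^+ k)%g.
Proof.
move=> [_ /image_stableP hS] ps hps q qs qp [b [g [sb Mg hq]]].
exists b, g; split=> // r; rewrite !homeoME contractionX_id; last first.
  exact: contraction_id_cone.
have hqs : h q \in s by exact/hS.
rewrite hq (acts_wprefix (in_cone_wprefix q n) hq).
case/andP: sb => /subnKC <- _; rewrite wprefixD wcat_cat.
set y := wcat _ (wcat _ _).
have cy : contraction (h p) y = y.
  by apply: contraction_id_cone => // /(@homeo_inj d).
by rewrite -{1}(contractionX_id l cy) homeo_invgK.
Qed.

(** Going [k] periods deep at [p] reaches a cone on which [h] acts through [M]; whole periods are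
    then removed from its image at [h p]. *)
Lemma tame_ex h p : H h -> p \in s -> (h p) \in s -> exists k l : nat,
  tame p (contraction (h p) ^- l * h * contraction p ^+ k)%g.
Proof.
move=> [hRN _] ps hps; have [k hk] := rn_uniform d_gt1 G_to_M n hRN.
have [|b [g [nb Mg hb]]] := hk (wprefix p (n + k * m)).
  by rewrite size_wprefix (leq_trans (leq_pmulr k m_gt0)) // leq_addl.
(* The remainder of [size b - n] modulo [m] is what stays beyond level [n], whence the bound
   [n + m]. *)
exists k, ((size b - n) %/ m); set l := _ %/ _.
have bE := acts_wprefix (in_cone_wprefix _ _) hb.
have sb : size b = n + l * m + (size b - n) %% m.
  by rewrite -addnA -divn_eq subnKC.
rewrite sb wprefixD in bE.
exists (wprefix (h p) n ++ wprefix (wdrop (n + l * m) (h p)) ((size b - n) %% m)), g.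
split=> //.
  by rewrite size_cat !size_wprefix leq_addr leq_add2l ltnW // ltn_mod.
rewrite -mulgA; apply: (acts_moves (b := b)).
  exact: moves_actsM (contractionX_moves ps k) hb.
rewrite {1}bE; apply: moves_cat; apply: movesV; exact: contractionX_moves.
Qed.

Definition germs (D : seq (cantor d * word d * tree_aut d)) h :=
  (forall p, p \in s -> exists2 x, x \in D & x.1.1 = p) /\
  forall x, x \in D -> acts h (wprefix x.1.1 n) x.1.2 x.2.

Definition germ_set : set (seq (cantor d * word d * tree_aut d)) :=
  [set D | size D <= size s /\ forall x, x \in D ->
    ([set` s] `*` [set b | size b <= n + m] `*` M) x].

(** One element of the stabilizer for each realized list of germs, and [1] for the others. *)
Definition representative D := xget 1%g [set h | H h /\ germs D h].

Definition generators : set (homeo (cantor d)) :=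
  short_flips n P M `|` contraction @` [set` s] `|` representative @` germ_set.

Lemma generators_finite : finite_set generators.
Proof.
rewrite /generators !finite_setU; split; first split.
- pose W := [set a : word d | size a <= n.+3].
  have finW : finite_set W by exact: finite_short_words.
  apply: sub_finite_set (finite_image (fun x => flip x.1.1 x.1.2 x.2)
    (finite_setX (finite_setX finW finW) M_finite)) => h.
  by move=> [a [b [g [_ _ [an bn] [_ Mg] ->]]]]; exists ((a, b), g).
- exact/finite_image/finite_seq.
- apply/finite_image/finite_bounded_seq/finite_setX => //.
  by apply: finite_setX; [exact: finite_seq|exact: finite_short_words].
Qed.

Lemma generators_sub : generators `<=` H.
Proof.
move=> h [[|[p ps <-]]|[D _ <-]].
- move=> [a [b [g [/andP[an Pa] /andP[bn Pb] _ [ab Mg] ->]]]].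
  split; first by apply: (rn_flip G_subgroup G_self_similar) => //; exact: sMG.
  have fixes q : q \in s -> flip a b g q = q.
    have nin c : n.+2 <= size c -> P (take n c) -> q \in s -> ~~ in_cone c q.
      move=> cn Pc qs; apply/negP => /(in_cone_prefix (prefix_take c n)).
      rewrite /in_cone size_takel; last by rewrite (leq_trans _ cn) // ltnW.
      by move=> /eqP qc; move: Pc; rewrite /P -qc wprefix_mem.
    by move=> qs; rewrite flip_id // nin.
  apply/image_stableP => q; split=> qs; last by rewrite (fixes _ qs).
  by rewrite -(homeo_inj (fixes _ qs)).
- exact: contraction_stabilizes.
- rewrite /representative; case: xgetP => [_ _ []//|_].
  exact: subgroup1.
Qed.

Lemma stabilizer_generated : smallest is_subgroup generators = H.
Proof.
apply/seteqP; split; first exact: smallest_sub Hs generators_sub.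
set F := smallest _ _; have Fs : is_subgroup F := smallest_subgroup generators.
have genF : generators `<=` F by exact: sub_gen_smallest.
have tameF h : H h -> (forall p, p \in s -> tame p h) -> F h.
  move=> Hh th.
  have [f fP] : {f : cantor d -> word d * tree_aut d & forall p, p \in s ->
      [/\ n <= size (f p).1 <= n + m, M (f p).2 &
        acts h (wprefix p n) (f p).1 (f p).2]}.
    apply: (@choice _ _ (fun p x => p \in s -> [/\ n <= size x.1 <= n + m, M x.2 &
        acts h (wprefix p n) x.1 x.2])) => p.
    have [/th[b [g bgP]]|] := boolP (p \in s); first by exists (b, g).
    by exists ([::], 1%g).
  pose D := [seq (p, (f p).1, (f p).2) | p <- s].
  have hD : germs D h.
    split=> [p ps|_ /mapP[p ps ->]]; last by have [] := fP p ps.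
    by exists (p, (f p).1, (f p).2); rewrite // map_f.
  have [Hr rD] : H (representative D) /\ germs D (representative D).
    exact: (@xgetPex _ _ [set h0 | H h0 /\ germs D h0] (ex_intro _ h (conj Hh hD))).
  set r := representative D in Hr rD.
  have Fr : F r.
    apply: genF; right; exists D => //; split; first by rewrite size_map.
    by move=> _ /mapP[p ps ->]; have [/andP[_ ?] ? _] := fP p ps.
  (* Since [r] and [h] have the same germs, [r^-1 * h] is the identity on the cones at [s]. *)
  rewrite -(mulVKg r h); apply: (subgroupM Fs Fr).
  have [Hrh _] : H (r^-1 * h)%g := subgroupM Hs (subgroupV Hs Hr) Hh.
  apply: (rn_supported_gen d_gt1 G_to_M (P := P) (n := n) M1 Fs size_a0) Hrh _ => //.
    by move=> k ?; apply: genF; left; left.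
  move=> p; rewrite negbK => /mapP[q qs pq].
  have [x xD xq] := hD.1 q qs.
  rewrite -(wcat_wdrop p n) pq -xq homeoME (hD.2 x xD) -(rD.2 x xD).
  by rewrite homeo_invgK.
have Fc p : p \in s -> F (contraction p).
  by move=> ps; apply: genF; left; right; exists p.
(* The list [t] holds the points at which [h] may still fail to be tame; each step removes its head
   and, by [tameX], preserves tameness elsewhere. *)
suff main (t : seq (cantor d)) h : {subset t <= s} -> H h ->
    (forall p, p \in s -> p \notin t -> tame p h) -> F h.
  by move=> h Hh; apply: (main s h) => // p ->.
elim: t h => [|p t IH] h ts Hh th; first by apply: tameF => // p ps; exact: th.
have ps : p \in s by apply: ts; rewrite mem_head.
have hps : h p \in s by have [_ /image_stableP hS] := Hh; exact/hS.
have [k [l tame_p]] := tame_ex Hh ps hps.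
set h' := (_ * _)%g in tame_p.
have FV : F (contraction (h p) ^- l)%g.
  by apply: (subgroupV Fs); apply: (subgroupX Fs); exact: Fc.
have FX : F (contraction p ^+ k)%g by apply: (subgroupX Fs); exact: Fc.
have Fh' : F h'.
  apply: IH => [q qt||q qs qt]; first by apply: ts; rewrite inE qt orbT.
    apply: (subgroupM Hs); last first.
      by apply: (subgroupX Hs); exact: contraction_stabilizes.
    apply: (subgroupM Hs) => //; apply: (subgroupV Hs).
    by apply: (subgroupX Hs); exact: contraction_stabilizes.
  have [->//|/eqP qp] := eqVneq q p.
  apply: tameX => //; apply: th => //.
  by rewrite inE negb_or qt andbT; exact/eqP.
have -> : h = ((contraction (h p) ^- l)^-1 * h' * (contraction p ^+ k)^-1)%g.
  by rewrite /h' !mulgA mulVg mul1g mulgK.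
apply: (subgroupM Fs); last exact: (subgroupV Fs FX).
by apply: (subgroupM Fs) => //; exact: (subgroupV Fs FV).
Qed.

End Stabilizer.

Theorem proposition6 (d : nat) (d_ge2 : (2 <= d)%N)
    (G : set (tree_aut d)) (G_subgroup : is_subgroup G)
    (G_self_similar : self_similar G) (G_contracting : contracting G)
    (S : set (cantor d)) (S_finite : finite_set S)
    (S_rational : forall p, S p -> rational p) :
  finitely_generated (setwise_stabilizer (rover_nekrashevych G) S).
Proof.
have [N [N_finite sNG GN]] := G_contracting.
have /finite_seqP[s sE] := S_finite; rewrite {}sE in S_rational *.
have [n [m [a0 [m0 sa0 a0s s_inj period]]]] := level_ex d_ge2 S_rational.
(* Adding [1] makes flips with trivial local action available. *)
pose M := N `|` [set 1%g].
have sMG : M `<=` G by move=> g [/sNG//|->]; exact: subgroup1.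
have M1 : M 1%g by right.
have M_finite : finite_set M by rewrite finite_setU; split=> //; exact: finite_set1.
have G_to_M g : G g -> exists k, forall a, k <= size a -> M (local_action g a).
  move=> /GN/finite_words_bounded[k kP]; exists k => a ka; left.
  by apply: contrapT => /kP; rewrite ltnNge ka.
exists (generators G M s n m a0); first exact: generators_finite.
exact: stabilizer_generated.
Qed.
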